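(* Let $\phi\colon\{0,1\}^n\to\{0,1\}$ be the structure function of an $n$-component semicoherent system whose component lifetimes $X_1,\ldots,X_n$ have an absolutely continuous joint c.d.f., and assume that the associated relative quality function $q$ is strictly positive. Let $T$ be the system lifetime and $p_k=\Pr(T=X_{k:n})$ for $k\in[n]$. Then the best symmetric approximation $\phi^*$ of $\phi$ with respect to the weight function $w=q$, that is, the unique symmetric function $\phi^*\colon\{0,1\}^n\to\mathbb{R}$ that minimizes $$ \sum_{\mathbf{x}\in\{0,1\}^n}q(\mathbf{x})\big(\phi(\mathbf{x})-g(\mathbf{x})\big)^2 $$ among all symmetric functions $g\colon\{0,1\}^n\to\mathbb{R}$, is given by $$ \phi^*=\sum_{k=1}^n p_k\,\mathrm{os}_{k:n}. $$
   Context: Notation: $[n]=\{1,\ldots,n\}$ and $|\mathbf{x}|=\sum_{i=1}^n x_i$ for $\mathbf{x}\in\{0,1\}^n$. Elements $\mathbf{x}\in\{0,1\}^n$ are identified with subsets $S=\{i: x_i=1\}$ of $[n]$, so a function on $2^{[n]}$ is also regarded as a function on $\{0,1\}^n$ and vice versa. A function on $\{0,1\}^n$ is symmetric if it is invariant under all permutations of its arguments. Semicoherent system: its structure function $\phi\colon\{0,1\}^n\to\{0,1\}$ is nondecreasing in each variable and satisfies $\phi(0,\ldots,0)=0$, $\phi(1,\ldots,1)=1$. Lifetimes: $X_1,\ldots,X_n$ are nonnegative random variables on a common probability space, $X_i$ being the lifetime of component $i$; their order statistics are $X_{1:n}\leqslant\cdots\leqslant X_{n:n}$. The joint c.d.f.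 is $F(t_1,\ldots,t_n)=\Pr(X_1\leqslant t_1,\ldots,X_n\leqslant t_n)$. The system lifetime is $T=\max_{1\leqslant j\leqslant m}\min_{i\in P_j}X_i$, where $P_1,\ldots,P_m$ are the minimal path sets of the system, i.e. the inclusion-minimal subsets $P\subseteq[n]$ with $\phi(P)=1$. Relative quality function: $q\colon 2^{[n]}\to[0,1]$ is defined by $q(S)=\Pr\big(\max_{i\in[n]\setminus S}X_i<\min_{j\in S}X_j\big)$, with the convention $q(\varnothing)=q([n])=1$. Order statistic functions: for $k\in[n]$, $\mathrm{os}_{k:n}\colon\{0,1\}^n\to\{0,1\}$ is defined by $\mathrm{os}_{k:n}(\mathbf{x})=x_{k:n}$ (the $k$th smallest coordinate of $\mathbf{x}$), i.e. $\mathrm{os}_{k:n}(\mathbf{x})=1$ if $|\mathbf{x}|\geqslant n-k+1$ and $0$ otherwise. *)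

(* Defs.v *)
From HB Require Import structures.
From mathcomp Require Import all_boot all_order all_fingroup all_algebra.
From mathcomp Require Import all_classical all_reals all_analysis.

Set Implicit Arguments.
Unset Strict Implicit.
Unset Printing Implicit Defensive.

Import Order.TTheory GRing.Theory Num.Theory.

Local Open Scope classical_set_scope.
Local Open Scope ring_scope.

(* {0,1}^n, with components indexed from 0 *)
Notation cube n := {ffun 'I_n -> bool}.

(* The identification of {0,1}^n with the subsets of [n] *)
Definition set_of_cube (n : nat) (x : cube n) : {set 'I_n} := [set i | x i]%SET.
Definition cube_of_set (n : nat) (S : {set 'I_n}) : cube n := [ffun i => i \in S].

(* x_{k:n}, the k-th smallest entry of x, for 1 <= k <= n (indexed from 1);
   the value x0 is only returned when k is out of range. *)
Definition order_stat (d : Order.disp_t) (V : orderType d) (x0 : V) (n k : nat)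
    (x : 'I_n -> V) : V :=
  nth x0 (sort <=%O [seq x i | i <- enum 'I_n]) k.-1.

Definition os (n k : nat) (x : cube n) : bool := order_stat false k x.

Definition symmetric_fun (n : nat) (V : Type) (g : cube n -> V) : Prop :=
  forall (s : 'S_n) (x : cube n), g [ffun i => x (s i)] = g x.

Section system.
Context {n : nat}.

Definition nondecreasing_each (phi : cube n -> bool) : Prop :=
  forall (i : 'I_n) (x y : cube n),
    (forall j, j != i -> x j = y j) -> x i ==> y i -> phi x ==> phi y.

Definition semicoherent (phi : cube n -> bool) : Prop :=
  [/\ nondecreasing_each phi,
      phi [ffun=> false] = false & phi [ffun=> true] = true].

Definition min_path_sets (phi : cube n -> bool) : {set {set 'I_n}} :=
  [set S | minset (fun S' => phi (cube_of_set S')) S]%SET.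

End system.

Section approximation.
Context {R : realType} {n : nat}.

Definition weighted_sq_dist (w : cube n -> R) (f g : cube n -> R) : R :=
  \sum_(x : cube n) w x * (f x - g x) ^+ 2.

Definition best_symmetric_approximation (w f g : cube n -> R) : Prop :=
  symmetric_fun g /\
  forall h : cube n -> R, symmetric_fun h ->
    weighted_sq_dist w f g <= weighted_sq_dist w f h.

End approximation.

(* The n-fold integral \int ... \int g(u_1, ..., u_n) du_n ... du_1 over R^n,
   each integral being taken with respect to Lebesgue measure on R. It is only
   used for nonnegative measurable g, for which the order is immaterial. *)
Fixpoint iterated_integral (R : realType) (n : nat) :
    (n.-tuple R -> \bar R) -> \bar R :=
  match n with
  | 0 => fun g => g [tuple]
  | m.+1 => fun g =>
      (\int[lebesgue_measure]_x
         iterated_integral (fun u : m.-tuple R => g [tuple of x :: u]))%E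
  end.

Section lifetimes.
Context {d : measure_display} {Omega : measurableType d} {R : realType}.
Context {P : probability Omega R} {n : nat}.
Variable X : 'I_n -> {RV P >-> R}.

Definition joint_cdf (t : n.-tuple R) : \bar R :=
  P [set w | forall i, X i w <= tnth t i].

(* F(t) is the integral of a density f over ]-oo, t_1] x ... x ]-oo, t_n]. *)
Definition absolutely_continuous_joint_cdf : Prop :=
  exists f : n.-tuple R -> R,
    [/\ measurable_fun setT f,
        forall u, 0 <= f u &
        forall t, joint_cdf t =
          iterated_integral
            ((EFin \o f) \_ [set u | forall i, tnth u i <= tnth t i])].

(* The maxima and minima are computed in the extended reals, so that those
   over the empty set are -oo and +oo; over nonempty sets they are the usual
   real ones. *)
Definition max_lifetime (A : {set 'I_n}) (w : Omega) : \bar R :=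
  \big[maxe/-oo%E]_(i in A) (X i w)%:E.
Definition min_lifetime (A : {set 'I_n}) (w : Omega) : \bar R :=
  \big[mine/+oo%E]_(i in A) (X i w)%:E.

(* Finite for semicoherent phi: there is a minimal path set, and each of them
   is nonempty. *)
Definition system_lifetime (phi : cube n -> bool) (w : Omega) : \bar R :=
  \big[maxe/-oo%E]_(A in min_path_sets phi) min_lifetime A w.

Definition order_stat_lifetime (k : nat) (w : Omega) : R :=
  order_stat 0 k (fun i => X i w).

Definition relative_quality (S : {set 'I_n}) : R :=
  if (S == finset.set0) || (S == finset.setT) then 1
  else fine (P [set w | (max_lifetime (~: S)%SET w < min_lifetime S w)%E]).

Definition prob_signature (phi : cube n -> bool) (k : nat) : R :=
  fine (P [set w | system_lifetime phi w = (order_stat_lifetime k w)%:E]).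

End lifetimes.

(* Main.v *)
Require Import Defs.
From HB Require Import structures.
From mathcomp Require Import all_boot all_order all_fingroup all_algebra.
From mathcomp Require Import all_classical all_reals all_analysis.
From mathcomp Require Import measurable_realfun.
From mathcomp Require Import ring zify.

(** A symmetric function on {0,1}^n depends only on the level |x|, so the
weighted least squares problem splits into one problem per level, and its
solution on a level is the mean of phi there with respect to the weights q
([unique_best_symmetric_approximation]). The theorem therefore says that, on
the level k, the weights q(y) sum to 1 ([sum_relative_quality]) and the
weighted sum of phi equals \sum_j p_j os_j ([sum_relative_quality_phi]).

Both follow from a statement about one outcome w at which the lifetimes are
pairwise distinct. The event whose probability is q(S) says that every
component in S outlives every component outside S; among the sets of size k
exactly one, the set of the k longest-lived components, has this property.
The system outlives the time c if and only if phi = 1 at the set of components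
that do, so for k >= 1 phi at the k longest-lived components is the indicator
of T >= X_{n-k+1:n}. Since T is one of the lifetimes, this is the sum over
j > n-k of the indicators of T = X_{j:n}, and os_j = 1 on the level k exactly
for these j ([sum_signature_os]). For k = 0 both sums vanish.

All events involved depend only on the comparisons X_i <= X_j, which take
finitely many joint values, so their probabilities are finite sums over
comparison tables ([prob_comparison]), and it suffices to compare the sums
table by table. A table of nonzero probability is realized by an outcome
without ties ([comparison_prob_neq0]), because P(X_i = X_j) = 0 ([no_tie]).
This is where absolute continuity enters: integrating the density over a set
defines a measure that agrees with the law of (X_1, ..., X_n) on lower
orthants, hence everywhere ([distribution_density]), and it vanishes on the
diagonal u_i = u_j because one of the integrals in the iterated integral then
runs over a single point ([iterated_integral_diagonal]). *)

Set Implicit Arguments.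
Unset Strict Implicit.
Unset Printing Implicit Defensive.
Import Order.TTheory GRing.Theory Num.Theory.

Local Open Scope classical_set_scope.
Local Open Scope ring_scope.

(** * Iterated integrals *)

Section iterated.
Variable R : realType.

Lemma iterated_integral_ge0 n (g : n.-tuple R -> \bar R) :
  (forall u, 0 <= g u)%E -> (0 <= iterated_integral g)%E.
Proof.
elim: n g => [|n IH] g g0 //=.
by apply: integral_ge0 => x _; apply: IH => u; apply: g0.
Qed.

(** The parameter t is needed for the induction: one more variable of
integration becomes part of the parameter, and Tonelli's theorem applies. *)
Lemma measurable_iterated_integral d (T : measurableType d) n
    (g : T * n.-tuple R -> \bar R) :
  measurable_fun setT g -> (forall z, 0 <= g z)%E ->
  measurable_fun setT (fun t => iterated_integral (fun u => g (t, u))).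
Proof.
elim: n d T g => [|n IH] d T g mg g0 /=.
  by apply: measurableT_comp => //; apply: measurable_fun_pair.
pose h (z : T * R) := iterated_integral (fun u => g (z.1, [tuple of z.2 :: u])).
suff : measurable_fun setT (fubini_F lebesgue_measure h) by [].
apply: measurable_fun_fubini_tonelli_F.
- apply: (IH _ _ (fun z : (T * R) * n.-tuple R =>
      g (z.1.1, [tuple of z.1.2 :: z.2]))) => //.
  apply: measurableT_comp => //; apply: measurable_fun_pair.
    by apply: measurableT_comp.
  by apply: measurable_cons => //; apply: measurableT_comp.
- by move=> z; apply: iterated_integral_ge0.
Qed.

Lemma measurable_iterated_integral_cons n (g : n.+1.-tuple R -> \bar R) :
  measurable_fun setT g -> (forall u, 0 <= g u)%E ->
  measurable_fun setT
    (fun x : R => iterated_integral (fun u => g [tuple of x :: u])).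
Proof.
move=> mg g0.
apply: (@measurable_iterated_integral _ _ _
  (fun z : R * n.-tuple R => g [tuple of z.1 :: z.2])) => //.
by apply: measurableT_comp => //; apply: measurable_cons.
Qed.

Lemma measurable_tuple_cons n (g : n.+1.-tuple R -> \bar R) (x : R) :
  measurable_fun setT g ->
  measurable_fun setT (fun u : n.-tuple R => g [tuple of x :: u]).
Proof.
by move=> mg; apply: measurableT_comp => //; apply: measurable_cons.
Qed.

(** Countable additivity of the iterated integral; [density_measure] is a
measure because of it. *)
Lemma iterated_integral_nneseries n (g : (n.-tuple R -> \bar R)^nat) :
  (forall k, measurable_fun setT (g k)) -> (forall k u, 0 <= g k u)%E ->
  iterated_integral (fun u => \sum_(0 <= k <oo) g k u)%E =
  (\sum_(0 <= k <oo) iterated_integral (g k))%E.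
Proof.
elim: n g => [|n IH] g mg g0 //=.
rewrite -integral_nneseries//=.
- apply: eq_integral => x _.
  apply: (IH (fun k u => g k [tuple of x :: u])) => //.
  by move=> k; apply: measurable_tuple_cons.
- by move=> k; apply: measurable_iterated_integral_cons.
- by move=> k x _; apply: iterated_integral_ge0.
Qed.

Lemma iterated_integral0 n :
  iterated_integral (fun _ : n.-tuple R => 0%E) = 0%E.
Proof.
elim: n => [|n IH] //=.
by under eq_integral do rewrite IH; rewrite integral0.
Qed.

(** The integral over the i-th variable has an integrand supported on the
single point c. *)
Lemma iterated_integral_hyperplane n (i : 'I_n) (c : R)
    (g : n.-tuple R -> \bar R) :
  (forall u, tnth u i != c -> g u = 0%E) -> iterated_integral g = 0%E.
Proof.
elim: n i g => [|n IH] [[|i] ilt] g g0 //=.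
- pose a := iterated_integral (fun u => g [tuple of c :: u]).
  transitivity (\int[lebesgue_measure]_(x in [set c]) a)%E.
    rewrite [RHS]integral_mkcond; apply: eq_integral => x _.
    rewrite /patch; have [|xc] := ifPn; first by rewrite inE => ->.
    rewrite (_ : (fun u => _) = fun=> 0%E) ?iterated_integral0//.
    apply/funext => u; apply: g0; rewrite (tnth_nth 0) /=.
    by apply: contra xc => /eqP ->; rewrite inE.
  by rewrite integral_set1.
- under eq_integral.
    move=> x _.
    rewrite (IH (Ordinal (ilt : (i < n)%N))); last first.
      move=> u uc; apply: g0; move: uc.
      by rewrite !(tnth_nth 0).
    over.
  by rewrite integral0.
Qed.

(** Once the outer variable u_i is fixed, the function of the remaining
variables is supported on the hyperplane u_j = u_i. *)
Lemma iterated_integral_diagonal n (i j : 'I_n) (g : n.-tuple R -> \bar R) :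
  (i < j)%N ->
  (forall u, tnth u i != tnth u j -> g u = 0%E) -> iterated_integral g = 0%E.
Proof.
elim: n i j g => [|n IH] [[|i] ilt] [[|j] jlt] g //= ij g0.
- under eq_integral.
    move=> x _.
    rewrite (@iterated_integral_hyperplane _ (Ordinal (jlt : (j < n)%N)) x).
      over.
    move=> u ux; apply: g0; move: ux; rewrite !(tnth_nth 0) /= eq_sym.
    by [].
  by rewrite integral0.
- under eq_integral.
    move=> x _.
    rewrite (IH (Ordinal (ilt : (i < n)%N)) (Ordinal (jlt : (j < n)%N))) //.
      over.
    by move=> u uij; apply: g0; move: uij; rewrite !(tnth_nth 0).
  by rewrite integral0.
Qed.

End iterated.

(** * Measures with a density *)

Section density_measure.
Context {R : realType} {n : nat} (f : n.-tuple R -> R).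
Hypothesis mf : measurable_fun setT f.
Hypothesis f0 : forall u, 0 <= f u.

Definition density_measure (A : set (n.-tuple R)) : \bar R :=
  iterated_integral ((EFin \o f) \_ A).

(* Writing the restriction with the Dirac measure at u turns countable
   additivity in A, at fixed u, into that of a measure. *)
Let restrict_dirac (A : set (n.-tuple R)) (u : n.-tuple R) :
  (((EFin \o f) \_ A) u = (f u)%:E * \d_u A)%E.
Proof.
rewrite diracE /patch; case: ifPn => _; first by rewrite mule1.
by rewrite mule0.
Qed.

Let restrict_ge0 (A : set (n.-tuple R)) u : (0 <= ((EFin \o f) \_ A) u)%E.
Proof. by rewrite restrict_dirac mule_ge0 // lee_fin. Qed.

Let density_measure0 : density_measure set0 = 0%E.
Proof.
rewrite -[RHS](iterated_integral0 R n); congr iterated_integral.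
by apply/funext => u; rewrite restrict_dirac measure0 mule0.
Qed.

Let density_measure_ge0 A : (0 <= density_measure A)%E.
Proof. by apply: iterated_integral_ge0. Qed.

Let density_measure_sigma_additive : semi_sigma_additive density_measure.
Proof.
move=> F mF tF mUF.
rewrite [X in _ --> X](_ : _ = \sum_(0 <= k <oo) density_measure (F k))%E.
  by apply: is_cvg_nneseries => k _ _; apply: density_measure_ge0.
rewrite -iterated_integral_nneseries//; last first.
  move=> k; apply/(measurable_restrictT _ (mF k)).
  apply: measurable_funTS; exact: measurableT_comp.
congr iterated_integral; apply/funext => u.
under eq_eseriesr do rewrite restrict_dirac.
rewrite restrict_dirac nneseriesZl//.
by rewrite measure_semi_bigcup.
Qed.

HB.instance Definition _ := isMeasure.Build _ _ _ density_measure
  density_measure0 density_measure_ge0 density_measure_sigma_additive.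

End density_measure.

Section orthants.
Context {R : realType} {n : nat}.

Definition orthant (t : n.-tuple R) : set (n.-tuple R) :=
  [set u | forall i, tnth u i <= tnth t i].

Lemma orthant_setI_closed : setI_closed (range orthant).
Proof.
move=> _ _ [s _ <-] [t _ <-].
exists [tuple Num.min (tnth s i) (tnth t i) | i < n] => //.
apply/seteqP; split => u /=.
  by move=> h; split => i; have := h i; rewrite tnth_mktuple le_min => /andP[].
by move=> [hs ht] i; rewrite tnth_mktuple le_min hs ht.
Qed.

Lemma measurable_orthant (t : n.-tuple R) : measurable (orthant t).
Proof.
rewrite (_ : orthant t =
    \bigcap_(i in setT) (tnth (T:=R) ^~ i @^-1` `]-oo, tnth t i])).
  apply: fin_bigcap_measurable => // i _.
  by rewrite -[X in measurable X]setTI; apply: measurable_tnth.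
apply/seteqP; split => u /=.
  by move=> h i _ /=; rewrite in_itv /=; apply: h.
by move=> h i; have := h i I; rewrite /= in_itv.
Qed.

(** Finiteness of the law on these orthants makes the uniqueness theorem for
measures applicable. *)
Lemma bigcup_orthant : \bigcup_k orthant [tuple k%:R | _ < n] = setT.
Proof.
apply/seteqP; split => // u _.
exists (\max_i Num.bound (tnth u i))%N => // i; rewrite tnth_mktuple.
apply: le_trans (ler_norm _) _; apply: ltW.
apply: lt_le_trans (archi_boundP (normr_ge0 _)) _.
rewrite ler_nat /Num.bound normr_id.
exact: (@leq_bigmax _ (fun i => Num.bound (tnth u i))).
Qed.

(** A half-space u_i > x is the complement of a countable union of orthants
whose i-th bound is x and whose other bounds tend to infinity, and half-spaces
generate the product sigma-algebra. *)
Lemma measurable_tupleE :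
  @measurable _ (n.-tuple R) = <<s range orthant >>.
Proof.
apply/seteqP; split; last first.
  apply: smallest_sub; first exact: sigma_algebra_measurable.
  by move=> _ [t _ <-]; apply: measurable_orthant.
apply: smallest_sub; first exact: smallest_sigma_algebra.
elim/big_ind: _ => [A []|F G FG GG|i _]; first by rewrite subUset.
have RE : (measurable : set (set R)) = <<s @RGenOInfty.G R >>.
  exact: RGenOInfty.measurableE.
rewrite RE -[X in X `<=` _]g_sigma_preimageE.
apply: smallest_sub => [|_ [_ [x ->] <-]].
  exact: smallest_sigma_algebra.
rewrite (_ : _ `&` _ = setT `\` \bigcup_k
    orthant [tuple if j == i then x else k%:R | j < n]).
  apply: sigma_algebraCD; apply: sigma_algebra_bigcup => k.
  by apply: sub_sigma_algebra; eexists.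
apply/seteqP; split => u /=; rewrite in_itv /= andbT => -[_].
  move=> xu; split => // -[k _ /(_ i)].
  by rewrite tnth_mktuple eqxx leNgt xu.
rewrite ltNge => nu; split => //; apply/negP => ux; apply: nu.
have [k _ uk] : (\bigcup_k orthant [tuple k%:R | _ < n]) u.
  by rewrite bigcup_orthant.
exists k => // j; rewrite tnth_mktuple; have [->//|_] := eqVneq j i.
by have := uk j; rewrite tnth_mktuple.
Qed.

End orthants.

Section no_ties.
Context {d : measure_display} {Omega : measurableType d} {R : realType}.
Context {P : probability Omega R} {n : nat}.
Variable X : 'I_n -> {RV P >-> R}.

Definition lifetime_vector (w : Omega) : n.-tuple R := [tuple X i w | i < n].

Let measurable_lifetime_vector : measurable_fun setT lifetime_vector.
Proof.
apply/measurable_fun_tnthP => i.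
rewrite (_ : _ \o _ = X i); first exact: measurable_funPT.
by apply/funext => w /=; rewrite tnth_mktuple.
Qed.

HB.instance Definition _ :=
  isMeasurableFun.Build _ _ _ _ lifetime_vector measurable_lifetime_vector.

Lemma joint_cdfE (t : n.-tuple R) :
  joint_cdf X t = distribution P lifetime_vector (orthant t).
Proof.
congr (P _); apply/seteqP; split => w /= h i; have := h i;
by rewrite tnth_mktuple.
Qed.

(** Lower orthants form a generating pi-system, so that the density, given on
them only through the joint c.d.f., determines the whole law. *)
Lemma distribution_density (f : n.-tuple R -> R)
    (mf : measurable_fun setT f) (f0 : forall u, 0 <= f u) :
  (forall t, joint_cdf X t = density_measure f (orthant t)) ->
  forall A, measurable A ->
    distribution P lifetime_vector A = density_measure f A.
Proof.
move=> cdf A mA.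
apply: (measure_unique (range orthant) (fun k => orthant [tuple k%:R | _ < n])
  measurable_tupleE orthant_setI_closed _ bigcup_orthant
  (distribution P lifetime_vector) (density_measure f)) => //.
- by move=> _ [t _ <-]; apply: etrans (esym (joint_cdfE t)) (cdf t).
- by move=> k; apply: le_lt_trans (probability_le1 _ _) (ltry _);
     apply: measurable_orthant.
Qed.

(** The diagonal u_i = u_j is a null set for every measure with a density. *)
Lemma no_tie (i j : 'I_n) : absolutely_continuous_joint_cdf X -> i != j ->
  P [set w | X i w = X j w] = 0%E.
Proof.
move=> [f [mf f0 cdf]]; wlog : i j / (i < j)%N => [hw ij|ij _].
  have [lt_ij|lt_ji|/val_inj eq_ij] := ltngtP i j.
  - exact: hw.
  - rewrite -[RHS](hw j i) // 1?eq_sym //.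
    by congr (P _); apply/seteqP; split => w /= ->.
  - by rewrite eq_ij eqxx in ij.
pose D := [set u : n.-tuple R | tnth u i = tnth u j].
have mD : measurable D.
  rewrite (_ : D = setT `&` (fun u => tnth u i == tnth u j) @^-1` [set true]).
    by apply: measurable_fun_eqr => //; apply: measurable_tnth.
  by rewrite setTI; apply/seteqP; split => u /= /eqP.
transitivity (distribution P lifetime_vector D).
  congr (P _); apply/seteqP; split => w /=; rewrite /D /=;
  by rewrite !tnth_mktuple.
rewrite (distribution_density mf f0) //.
apply: (iterated_integral_diagonal ij) => u uij.
rewrite /patch; case: ifPn => //.
by rewrite inE /D /= => /eqP; rewrite (negbTE uij).
Qed.

End no_ties.

(** * Symmetric least squares approximation *)

Section level.
Context {n : nat}.

Definition level (x : cube n) : nat := #|set_of_cube x|.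

Lemma levelE (x : cube n) : level x = count x (enum 'I_n).
Proof. by rewrite /level cardsE cardE enumT /enum_mem size_filter. Qed.

Lemma level_le (x : cube n) : (level x <= n)%N.
Proof. by rewrite -[leqRHS]card_ord max_card. Qed.

Lemma level_perm (s : 'S_n) (x : cube n) : level [ffun i => x (s i)] = level x.
Proof.
rewrite /level -[RHS](card_preimset _ (@perm_inj _ s)); apply: eq_card => i.
by rewrite !inE ffunE.
Qed.

(** Two Boolean vectors of the same level have the same multiset of entries. *)
Lemma eq_level_perm (x y : cube n) : level x = level y ->
  exists s : 'S_n, y = [ffun i => x (s i)].
Proof.
move=> xy.
have cm (z : cube n) (b : bool) : count_mem b [tuple z i | i < n] =
    if b then level z else (n - level z)%N.
  rewrite levelE count_map val_ord_tuple; case: b.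
    by apply: eq_count => i /=; rewrite eqb_id.
  rewrite -[X in (X - _)%N](size_enum_ord n) -(count_predC z) addKn.
  by apply: eq_count => i /=; rewrite eqbF_neg.
have /tuple_permP[s ys] : perm_eq [tuple y i | i < n] [tuple x i | i < n].
  by apply/allP => b _ /=; rewrite !cm xy.
exists s; apply/ffunP => i; rewrite ffunE.
have /val_inj/(congr1 (fun t => tnth t i)) := ys.
by rewrite !tnth_mktuple.
Qed.

Lemma symmetric_fun_level (V : Type) (h : cube n -> V) (x y : cube n) :
  symmetric_fun h -> level x = level y -> h x = h y.
Proof. by move=> hs /eq_level_perm[s ->]; rewrite hs. Qed.

End level.

Section approximation.
Context {R : realType} {n : nat}.
Variables q f g : cube n -> R.
Hypothesis q_gt0 : forall x, 0 < q x.
Hypothesis g_sym : symmetric_fun g.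
Hypothesis residual0 : forall x : cube n,
  \sum_(y : cube n | level y == level x) q y * (f y - g y) = 0.

(** On each level h is constant and factors out of the sum, leaving a sum of
residuals that vanishes. *)
Lemma symmetric_residual0 (h : cube n -> R) : symmetric_fun h ->
  \sum_x h x * (q x * (f x - g x)) = 0.
Proof.
move=> h_sym.
rewrite (partition_big (fun x => inord (level x) : 'I_n.+1) xpredT) //=.
apply: big1 => k _.
case: (pickP (fun x : cube n => inord (level x) == k)) => [x /eqP xk|no];
  last by rewrite big_pred0.
transitivity (h x * \sum_(y : cube n | level y == level x) q y * (f y - g y)).
  rewrite mulr_sumr; apply: eq_big => [y|y /eqP yk].
    apply/eqP/eqP => [yk|->//].
    have /(congr1 val) := etrans yk (esym xk).
    by rewrite /= !inordK // ltnS level_le.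
  congr (_ * _); apply: symmetric_fun_level => //.
  have /(congr1 val) := etrans yk (esym xk).
  by rewrite /= !inordK // ltnS level_le.
by rewrite residual0 mulr0.
Qed.

(** Pythagoras: the residual f - g is orthogonal to the symmetric functions,
in particular to g - h. *)
Lemma weighted_sq_dist_symmetric (h : cube n -> R) : symmetric_fun h ->
  weighted_sq_dist q f h =
  weighted_sq_dist q f g + \sum_x q x * (g x - h x) ^+ 2.
Proof.
move=> h_sym.
have gh_sym : symmetric_fun (fun x => g x - h x).
  by move=> s x; rewrite g_sym h_sym.
transitivity (weighted_sq_dist q f g + \sum_x q x * (g x - h x) ^+ 2
    + 2 * \sum_x (g x - h x) * (q x * (f x - g x))); last first.
  by rewrite (symmetric_residual0 gh_sym) mulr0 addr0.
rewrite mulr_sumr -!big_split /=; apply: eq_bigr => x _; ring.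
Qed.

Lemma unique_best_symmetric_approximation :
  unique (best_symmetric_approximation q f) g.
Proof.
split.
  split=> // h h_sym; rewrite (weighted_sq_dist_symmetric h_sym) lerDl.
  by apply: sumr_ge0 => x _; rewrite mulr_ge0 ?sqr_ge0 // ltW.
move=> h [h_sym /(_ g g_sym)].
rewrite (weighted_sq_dist_symmetric h_sym) gerDl => le0.
have ge0 x : 0 <= q x * (g x - h x) ^+ 2 by rewrite mulr_ge0 ?sqr_ge0 // ltW.
have /eqP : \sum_x q x * (g x - h x) ^+ 2 = 0.
  by apply/le_anti; rewrite le0 sumr_ge0.
rewrite psumr_eq0 // => /allP all0; apply/funext => x.
have := all0 x (mem_index_enum x).
by rewrite /= mulf_eq0 (gt_eqF (q_gt0 x)) /= sqrf_eq0 subr_eq0 => /eqP.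
Qed.

End approximation.

(** * Order statistics *)

Section order_stat.
Context {disp : Order.disp_t} {V : orderType disp} (x0 : V) {n : nat}.
Implicit Types (x : 'I_n -> V) (k : nat).

Let count_codom (p : pred V) x :
  count p (sort <=%O [seq x i | i <- enum 'I_n]) = #|[set i | p (x i)]%SET|.
Proof.
by rewrite count_sort count_map cardsE cardE enumT /enum_mem size_filter.
Qed.

Let size_sorted x : size (sort <=%O [seq x i | i <- enum 'I_n]) = n.
Proof. by rewrite size_sort size_map size_enum_ord. Qed.

(** This counting form of the order statistics replaces the sorted sequence in
all later arguments. *)
Lemma le_order_stat x k c : (0 < k <= n)%N ->
  (c <= order_stat x0 k x)%O = (#|[set i | (x i < c)%O]%SET| < k)%N.
Proof.
case: k => // k /= kn; rewrite ltnS -(count_codom (fun y => (y < c)%O)).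
have [le_k|gt_k] := leqP.
  by apply: nth_count_ge; rewrite ?sort_le_sorted // le_k size_sorted.
by apply/negbTE; rewrite -ltNge; apply: nth_count_lt; rewrite ?sort_le_sorted.
Qed.

Lemma order_stat_codom x k : (0 < k <= n)%N ->
  exists i, order_stat x0 k x = x i.
Proof.
case: k => // k /= kn.
have : order_stat x0 k.+1 x \in [seq x i | i <- enum 'I_n].
  by rewrite -(mem_sort <=%O) mem_nth // size_sorted.
by case/mapP => i _ ->; exists i.
Qed.

Lemma codom_order_stat x i :
  exists2 k, (0 < k <= n)%N & x i = order_stat x0 k x.
Proof.
have xi : x i \in sort <=%O [seq x i | i <- enum 'I_n].
  by rewrite mem_sort map_f // mem_enum.
exists (index (x i) (sort <=%O [seq x i | i <- enum 'I_n])).+1.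
  by move: xi; rewrite -index_mem size_sorted.
by rewrite /order_stat nth_index.
Qed.

Lemma card_lt_order_stat x k : injective x -> (0 < k <= n)%N ->
  #|[set i | (x i < order_stat x0 k x)%O]%SET| = k.-1.
Proof.
move=> x_inj; case: k => // k /= kn.
rewrite -(count_codom (fun y => (y < order_stat x0 k.+1 x)%O)).
apply: count_lt_nth; last by rewrite size_sorted.
by rewrite sort_lt_sorted map_inj_uniq ?enum_uniq.
Qed.

Lemma le_order_stat2 x j k : injective x -> (0 < j <= n)%N -> (0 < k <= n)%N ->
  (order_stat x0 j x <= order_stat x0 k x)%O = (j <= k)%N.
Proof.
move=> x_inj jn kn; rewrite le_order_stat // card_lt_order_stat //.
by case: j jn.
Qed.

End order_stat.

(** The case V = bool of [le_order_stat]: the entries below true are those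
outside the set of x. *)
Lemma osE n k (x : cube n) : (0 < k <= n)%N -> os k x = (n - level x < k)%N.
Proof.
move=> kn; have -> : os k x = (true <= os k x)%O by case: (os k x).
rewrite le_order_stat //; congr (_ < _)%N.
rewrite -[X in (X - _)%N](card_ord n) -(cardsC (set_of_cube x)) addKn.
by apply: eq_card => i; rewrite !inE; case: (x i).
Qed.

(** * Lifetimes at a single outcome *)

(** Monotonicity in each variable gives monotonicity for the product order, by
passing from x to y one coordinate at a time. *)
Lemma nondecreasing_eachW n (phi : cube n -> bool) (x y : cube n) :
  nondecreasing_each phi -> (forall i, x i -> y i) -> phi x -> phi y.
Proof.
move=> phi_nd xy phix.
(* the first k coordinates have been moved from x to y *)
pose z k : cube n := [ffun i : 'I_n => if (i < k)%N then y i else x i].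
suff phiz k : (k <= n)%N -> phi (z k).
  suff <- : z n = y by apply: phiz.
  by apply/ffunP => i; rewrite ffunE ltn_ord.
elim: k => [_|k IH kn].
  by suff -> : z 0 = x by []; apply/ffunP => i; rewrite ffunE.
have := IH (ltnW kn); apply/implyP.
apply: (phi_nd (Ordinal kn)) => [j jk|].
  rewrite !ffunE ltnS [in RHS]leq_eqVlt.
  have /negbTE -> // : val j != k.
  by apply: contra jk => /eqP jk; apply/eqP/val_inj.
by rewrite !ffunE /= ltnn ltnSn; apply/implyP/xy.
Qed.

Lemma min_path_set_exists n (phi : cube n -> bool) (x : cube n) : phi x ->
  exists2 A, A \in min_path_sets phi & A \subset set_of_cube x.
Proof.
move=> phix; pose Q (S : {set 'I_n}) := phi (cube_of_set S).
have [|A minA Ax] := @minset_exists _ Q (set_of_cube x).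
  rewrite /Q (_ : cube_of_set _ = x) //.
  by apply/ffunP => i; rewrite ffunE inE.
by exists A; rewrite // inE.
Qed.

Section pointwise.
Context {d : measure_display} {Omega : measurableType d} {R : realType}.
Context {P : probability Omega R} {n : nat}.
Variables (X : 'I_n -> {RV P >-> R}) (phi : cube n -> bool).
Hypothesis phi_semicoherent : semicoherent phi.

(** The system is alive at time c exactly when its surviving components form a
path set: a set satisfies phi if and only if it contains a minimal path set. *)
Lemma le_system_lifetime (c : R) (w : Omega) :
  (c%:E <= system_lifetime X phi w)%E = phi [ffun i => c <= X i w].
Proof.
have [phi_nd _ _] := phi_semicoherent.
apply/idP/idP => [/bigmax_geP[//|[A]]|phic].
  rewrite inE => /minsetP[phiA _] /bigmin_geP[_ cA].
  apply: nondecreasing_eachW phi_nd _ phiA => i; rewrite !ffunE => iA.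
  by rewrite -lee_fin cA.
have [A minA AU] := min_path_set_exists phic.
apply/bigmax_geP; right; exists A => //.
apply/bigmin_geP; split=> [|i iA]; first by rewrite leey.
by have := fintype.subsetP AU _ iA; rewrite inE ffunE lee_fin.
Qed.

Lemma min_lifetime_codom (A : {set 'I_n}) i0 (w : Omega) : i0 \in A ->
  exists i, min_lifetime X A w = (X i w)%:E.
Proof.
move=> Ai0; rewrite /min_lifetime (bigmin_eq_arg _ i0 _ _ Ai0) => [|i _].
  by eexists.
by rewrite leey.
Qed.

(** There is a minimal path set since phi(1,...,1) = 1, and minimal path sets
are nonempty since phi(0,...,0) = 0, so the maximum and the minima in T are
attained. *)
Lemma system_lifetime_codom (w : Omega) :
  exists i, system_lifetime X phi w = (X i w)%:E.
Proof.
have [_ phi0 phi1] := phi_semicoherent.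
have [A0 minA0 _] := min_path_set_exists phi1.
rewrite /system_lifetime.
rewrite (bigmax_eq_arg _ A0 _ _ minA0); last first.
  by move=> A _; rewrite leNye.
case: arg_maxP => // A A_min _.
have {A_min} : A \in min_path_sets phi := A_min.
rewrite inE => /minsetp phiA.
have [i iA] : exists i, i \in A.
  apply/set0Pn/negP => /eqP A_empty; move: phiA; rewrite A_empty.
  rewrite (_ : cube_of_set _ = [ffun=> false]) ?phi0 //.
  by apply/ffunP => i; rewrite !ffunE inE.
exact: min_lifetime_codom iA.
Qed.

(** The conventions max = -oo and min = +oo on the empty set make the right-hand
side correct for every S. *)
Lemma lt_max_min_lifetime (S : {set 'I_n}) (w : Omega) :
  (max_lifetime X (~: S)%SET w < min_lifetime X S w)%E =
  [forall i, forall j, (i \notin S) && (j \in S) ==> (X i w < X j w)].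
Proof.
apply/idP/forallP => [|lt].
  move=> /bigmax_ltP[_ ltS] i; apply/forallP => j; apply/implyP => /andP[iS jS].
  have := ltS i; rewrite inE iS => /(_ isT) /bigmin_gtP[_ /(_ j jS)].
  by rewrite lte_fin.
apply/bigmax_ltP; split=> [|i].
  by apply/bigmin_gtP; split=> // j _; rewrite ltNyr.
rewrite inE => iS; apply/bigmin_gtP; split=> [|j jS]; first by rewrite ltry.
by have /forallP/(_ j) := lt i; rewrite iS jS lte_fin.
Qed.

(** Both T and the order statistic are values of the lifetimes, so they agree
as soon as they lie above the same lifetimes X_i; and X_i <= T as well as
X_i <= X_{k:n} are determined by comparisons with X_i. *)
Lemma eq_system_order_stat k (w : Omega) : (0 < k <= n)%N ->
  (system_lifetime X phi w == (order_stat_lifetime X k w)%:E) =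
  [forall i, phi [ffun j => X i w <= X j w] ==
             (#|[set j | (X j w < X i w)%R]%SET| < k)%N].
Proof.
move=> kn; have [i0 T_i0] := system_lifetime_codom w.
have [i1 s_i1] := order_stat_codom 0 (fun i => X i w) kn.
apply/eqP/forallP => [Ts i|all_eq].
  by rewrite -le_system_lifetime -(le_order_stat 0 _ _ kn) Ts lee_fin.
have le_iff i : ((X i w)%:E <= system_lifetime X phi w)%E =
    (X i w <= order_stat_lifetime X k w).
  by rewrite le_system_lifetime (eqP (all_eq i)) (le_order_stat 0 _ _ kn).
rewrite T_i0 /order_stat_lifetime s_i1; congr EFin; apply/le_anti.
move: (le_iff i0) (le_iff i1).
by rewrite T_i0 /order_stat_lifetime s_i1 !lee_fin !lexx => <- ->.
Qed.

End pointwise.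

(** * Events determined by comparisons *)

Section comparisons.
Context {d : measure_display} {Omega : measurableType d} {R : realType}.
Context {P : probability Omega R} {n : nat}.
Variable X : 'I_n -> {RV P >-> R}.

Definition comparison (w : Omega) : {ffun 'I_n * 'I_n -> bool} :=
  [ffun ij => X ij.1 w <= X ij.2 w].

(** The law of the comparison table. *)
Definition comparison_prob (m : {ffun 'I_n * 'I_n -> bool}) : R :=
  fine (P (comparison @^-1` [set m])).

Lemma measurable_comparison m : measurable (comparison @^-1` [set m]).
Proof.
rewrite (_ : _ @^-1` _ = \bigcap_(ij in setT)
    (fun w => X ij.1 w <= X ij.2 w) @^-1` [set m ij]).
  apply: fin_bigcap_measurable => // ij _; rewrite -[X in measurable X]setTI.
  by apply: measurable_fun_ler => //; apply: measurable_funPT.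
apply/seteqP; split => w /= => [wm ij _ /=|h]; first by rewrite -wm ffunE.
by apply/ffunP => ij; rewrite ffunE; apply: (h ij I).
Qed.

(** The finitely many fibres of [comparison] partition the probability space. *)
Lemma prob_comparison (b : pred {ffun 'I_n * 'I_n -> bool}) :
  fine (P [set w | b (comparison w)]) =
  \sum_m comparison_prob m * (b m)%:R.
Proof.
have -> : [set w | b (comparison w)] =
    \bigcup_(m in [set` b]) (comparison @^-1` [set m]).
  apply/seteqP; split => w /=; first by move=> bw; exists (comparison w).
  by move=> [m /= bm ->].
rewrite measure_fin_bigcup //; last 2 first.
- by move=> m m' _ _ [w [/= wm wm']]; rewrite -wm -wm'.
- by move=> m _; apply: measurable_comparison.
rewrite -(bigfs _ (index_enum_uniq _)) => [|m _];
  last by rewrite mem_index_enum.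
rewrite -sum_fine => [|m _]; last first.
  by apply: fin_num_measure; apply: measurable_comparison.
rewrite [LHS]big_mkcond /=; apply: eq_bigr => m _.
by case: (b m); rewrite ?mulr1 ?mulr0.
Qed.

(** A table of nonzero probability has a nonempty fibre. If some outcome in the
fibre had X_i = X_j with i != j, then the table would force X_i = X_j on the
whole fibre, which would be a null set. *)
Lemma comparison_prob_neq0 m : absolutely_continuous_joint_cdf X ->
  comparison_prob m != 0 ->
  exists2 w, comparison w = m & injective (X ^~ w).
Proof.
move=> X_ac m_neq0; have [w wm] : comparison @^-1` [set m] !=set0.
  apply/set0P; apply: contra m_neq0 => /eqP m0.
  by rewrite /comparison_prob m0 measure0.
exists w => // i j ij; apply/eqP; apply: contraNT m_neq0 => neq_ij.
have mij u : comparison u = m -> X i u = X j u.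
  move=> um; have cmp : comparison u = comparison w by rewrite um wm.
  apply/le_anti/andP; split.
    by have /ffunP/(_ (i, j)) := cmp; rewrite !ffunE /= ij lexx.
  by have /ffunP/(_ (j, i)) := cmp; rewrite !ffunE /= ij lexx.
rewrite /comparison_prob (_ : P _ = 0%E) //; apply/eqP.
rewrite -measure_le0 -(no_tie X_ac neq_ij); apply: le_measure => //.
- by rewrite inE; apply: measurable_comparison.
- rewrite inE (_ : [set _ | _] =
      setT `&` (fun w => X i w == X j w) @^-1` [set true]).
    by apply: measurable_fun_eqr => //; apply: measurable_funPT.
  by rewrite setTI; apply/seteqP; split => u /= /eqP.
Qed.

End comparisons.

(** * Sets of longest-lived components *)

Section upper_sets.
Context {R : realType} {n : nat}.
Implicit Types (x : 'I_n -> R) (S : {set 'I_n}).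

(** Every value of x inside S exceeds every value outside S. *)
Definition upper_set x S :=
  [forall i, forall j, (i \notin S) && (j \in S) ==> (x i < x j)].

Lemma upper_set_lt x S i j :
  upper_set x S -> i \notin S -> j \in S -> x i < x j.
Proof. by move=> /forallP/(_ i)/forallP/(_ j) + iS jS; rewrite iS jS. Qed.

(** Upper sets form a chain. *)
Lemma upper_set_inj x S S' :
  upper_set x S -> upper_set x S' -> #|S| = #|S'| -> S = S'.
Proof.
move=> Sup S'up SS'; apply/eqP.
have [sub|/fintype.subsetPn[i iS iS']] := boolP (S \subset S').
  by rewrite eqEcard sub SS' leqnn.
have sub : S' \subset S.
  apply/fintype.subsetP => j jS'; apply/negPn/negP => jS.
  by have := lt_trans (upper_set_lt Sup jS iS) (upper_set_lt S'up iS' jS');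
     rewrite ltxx.
by rewrite eq_sym eqEcard sub SS' leqnn.
Qed.

Lemma upper_set_ge x (c : R) : upper_set x [set i | c <= x i]%SET.
Proof.
apply/forallP => i; apply/forallP => j; apply/implyP.
by rewrite !inE -ltNge => /andP[]; apply: lt_le_trans.
Qed.

Lemma card_ge_order_stat x k : injective x -> (0 < k <= n)%N ->
  #|[set i | order_stat 0 (n - k).+1 x <= x i]%SET| = k.
Proof.
move=> x_inj /andP[k_gt0 kn].
have jn : (0 < (n - k).+1 <= n)%N by rewrite /= -subSn // leq_subLR; lia.
have := card_lt_order_stat 0 x_inj jn; rewrite /=.
set A := [set i | _]%SET => cardA.
rewrite (_ : [set i | _]%SET = (~: A)%SET); last first.
  by apply/setP => i; rewrite !inE leNgt.
apply/(@addnI (n - k)%N).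
by rewrite -[X in (X + _)%N]cardA cardsC card_ord subnK.
Qed.

End upper_sets.

(** * Quality and signature as comparison events *)

Section signature.
Context {d : measure_display} {Omega : measurableType d} {R : realType}.
Context {P : probability Omega R} {n : nat}.
Variables (X : 'I_n -> {RV P >-> R}) (phi : cube n -> bool).
Hypothesis phi_semicoherent : semicoherent phi.
Local Notation cmp := {ffun 'I_n * 'I_n -> bool}.

Definition quality_event (S : {set 'I_n}) (m : cmp) : bool :=
  [forall i, forall j, (i \notin S) && (j \in S) ==> ~~ m (j, i)].

Definition signature_event (k : nat) (m : cmp) : bool :=
  [forall i, phi [ffun j => m (i, j)] == (#|[set j | ~~ m (i, j)]%SET| < k)%N].

Lemma quality_event_comparison S w :
  quality_event S (comparison X w) = upper_set (X ^~ w) S.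
Proof.
by apply: eq_forallb => i; apply: eq_forallb => j; rewrite ffunE -ltNge.
Qed.

Lemma signature_event_comparison k w : (0 < k <= n)%N ->
  signature_event k (comparison X w) =
  (system_lifetime X phi w == (order_stat_lifetime X k w)%:E).
Proof.
move=> kn; rewrite eq_system_order_stat //; apply: eq_forallb => i.
congr (phi _ == (_ < _)%N).
  by apply/ffunP => j; rewrite !ffunE.
by apply: eq_card => j; rewrite !inE ffunE ltNge.
Qed.

Lemma relative_qualityE S :
  relative_quality X S =
  \sum_m comparison_prob X m * (quality_event S m)%:R.
Proof.
rewrite -prob_comparison /relative_quality; case: ifPn => [S_trivial|_].
  rewrite (_ : [set _ | _] = setT) ?probability_setT //.
  apply/seteqP; split => // w _ /=.
  apply/forallP => i; apply/forallP => j; apply/implyP.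
  by case/orP: S_trivial => /eqP ->; rewrite !inE // andbF.
congr (fine (P _)); apply/seteqP; split => w /=;
by rewrite quality_event_comparison lt_max_min_lifetime.
Qed.

Lemma prob_signatureE k : (0 < k <= n)%N ->
  prob_signature X phi k =
  \sum_m comparison_prob X m * (signature_event k m)%:R.
Proof.
move=> kn; rewrite -prob_comparison; congr (fine (P _)).
apply/seteqP; split => w /=; rewrite signature_event_comparison //.
  by move=> ->.
by move/eqP.
Qed.

(** The k longest-lived components. For k > 0 they are those with lifetime at
least X_{n-k+1:n}; for k = 0 this order statistic does not exist, and the set
is empty. *)
Lemma upper_cube_exists k (x : 'I_n -> R) : injective x -> (k <= n)%N ->
  exists2 y : cube n, level y = k &
    upper_set x (set_of_cube y) /\
    ((0 < k)%N -> y = [ffun i => order_stat 0 (n - k).+1 x <= x i]).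
Proof.
move=> x_inj; case: k => [_|k kn].
  have y0 : set_of_cube [ffun=> false] = finset.set0 :> {set 'I_n}.
    by apply/setP => i; rewrite !inE ffunE.
  exists [ffun=> false]; first by rewrite /level y0 cards0.
  split=> //; rewrite y0; apply/forallP => i; apply/forallP => j.
  by rewrite !inE andbF.
pose y : cube n := [ffun i => order_stat 0 (n - k.+1).+1 x <= x i].
have yE : set_of_cube y = [set i | order_stat 0 (n - k.+1).+1 x <= x i]%SET.
  by apply/setP => i; rewrite !inE ffunE.
exists y; first by rewrite /level yE card_ge_order_stat.
by split=> //; rewrite yE; apply: upper_set_ge.
Qed.

(** Let y be the set of the k longest-lived components, with k the level of x,
and write T = X_{k0:n}. The sum has the single nonzero term os_{k0:n}(x), which
is 1 if and only if k0 > n - k, that is, T >= X_{n-k+1:n}, that is,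
phi y = 1. *)
Lemma sum_signature_os w (x y : cube n) : injective (X ^~ w) ->
  level y = level x ->
  ((0 < level x)%N ->
    y = [ffun i => order_stat_lifetime X (n - level x).+1 w <= X i w]) ->
  \sum_(1 <= k < n.+1)
    (system_lifetime X phi w == (order_stat_lifetime X k w)%:E)%:R
      * (os k x)%:R = (phi y)%:R :> R.
Proof.
move=> x_inj yx yE.
have [i Ti] := system_lifetime_codom X phi_semicoherent w.
have [k0 k0n ik0] := codom_order_stat 0 (X ^~ w) i.
transitivity ((os k0 x)%:R : R).
  have -> : (os k0 x)%:R =
      \sum_(1 <= k < n.+1 | k == k0) (os k x)%:R :> R.
    by rewrite big_nat1_eq ltnS k0n.
  rewrite [RHS]big_mkcond; apply: eq_big_nat => k kn.
  have {}kn : (0 < k <= n)%N by [].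
  rewrite Ti ik0 eqe eq_le !le_order_stat2 // -eqn_leq eq_sym.
  by case: eqP; rewrite ?mul1r ?mul0r.
rewrite osE //; congr (_%:R : R); congr nat_of_bool.
have := level_le x; case: (posnP (level x)) => [x0 _|x_gt0 xn].
  have -> : y = [ffun=> false].
    apply/ffunP => j; rewrite ffunE; apply/negbTE/negP => yj.
    have : j \in set_of_cube y by rewrite inE.
    by rewrite (cards0_eq (etrans yx x0)) inE.
  have [_ -> _] := phi_semicoherent.
  by rewrite x0 subn0 ltnNge; case/andP: k0n => _ ->.
rewrite yE // -le_system_lifetime // Ti ik0 lee_fin le_order_stat2 //.
by lia.
Qed.

End signature.

(** * Sums over a level *)

Section assembly.
Context {d : measure_display} {Omega : measurableType d} {R : realType}.
Context {P : probability Omega R} {n : nat}.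
Variables (X : 'I_n -> {RV P >-> R}) (phi : cube n -> bool).
Hypothesis phi_semicoherent : semicoherent phi.
Hypothesis X_ac : absolutely_continuous_joint_cdf X.

(** Expresses a weighted sum over a level as an expectation over comparison
tables, which reduces its computation to single outcomes without ties. *)
Lemma sum_level_relative_quality (F : cube n -> R) (x : cube n) :
  \sum_(y : cube n | level y == level x)
    relative_quality X (set_of_cube y) * F y =
  \sum_m comparison_prob X m * (\sum_(y : cube n | level y == level x)
    (quality_event (set_of_cube y) m)%:R * F y).
Proof.
under [LHS]eq_bigr do rewrite relative_qualityE mulr_suml.
rewrite exchange_big; apply: eq_bigr => m _.
by rewrite mulr_sumr; apply: eq_bigr => y _; rewrite mulrA.
Qed.

(** Without ties, the only set of a given size that is an upper set is the set
of longest-lived components, so a single term of the sum survives. *)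
Lemma sum_quality_event (F : cube n -> R) (x : cube n) w :
  injective (X ^~ w) ->
  exists y : cube n, [/\ level y = level x,
    ((0 < level x)%N ->
      y = [ffun i => order_stat_lifetime X (n - level x).+1 w <= X i w]) &
    \sum_(z : cube n | level z == level x)
      (quality_event (set_of_cube z) (comparison X w))%:R * F z = F y].
Proof.
move=> x_inj.
have [y yx [y_up yE]] := upper_cube_exists x_inj (level_le x).
exists y; split=> //.
rewrite (bigD1 y) ?yx //= quality_event_comparison y_up mul1r.
rewrite big1 ?addr0 // => z /andP[/eqP zx].
rewrite quality_event_comparison; case: (boolP (upper_set _ _)) => [z_up|].
  have /setP zy := upper_set_inj z_up y_up (etrans zx (esym yx)).
  have -> : z = y by apply/ffunP => i; have := zy i; rewrite !inE.
  by rewrite eqxx.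
by rewrite mul0r.
Qed.

(** Almost surely exactly one set of each size is an upper set for the
lifetimes. *)
Lemma sum_relative_quality (x : cube n) :
  \sum_(y : cube n | level y == level x) relative_quality X (set_of_cube y) = 1.
Proof.
transitivity (\sum_(y : cube n | level y == level x)
    relative_quality X (set_of_cube y) * 1).
  by apply: eq_bigr => y _; rewrite mulr1.
rewrite (sum_level_relative_quality (fun=> 1)).
transitivity (\sum_m comparison_prob X m * (predT m)%:R).
  apply: eq_bigr => m _.
  have [->|m_neq0] := eqVneq (comparison_prob X m) 0; first by rewrite !mul0r.
  have [w <- x_inj] := comparison_prob_neq0 X_ac m_neq0.
  by have [y [_ _ ->]] := sum_quality_event (fun=> 1) x x_inj.
rewrite -prob_comparison (_ : [set _ | _] = setT) ?probability_setT //.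
by apply/seteqP.
Qed.

(** Both sides are expectations of the same quantity: almost surely, the value
of phi at the set of the longest-lived components, as many as the level of x. *)
Lemma sum_relative_quality_phi (x : cube n) :
  \sum_(y : cube n | level y == level x)
    relative_quality X (set_of_cube y) * (phi y)%:R =
  \sum_(1 <= k < n.+1) prob_signature X phi k * (os k x)%:R.
Proof.
rewrite (sum_level_relative_quality (fun y => (phi y)%:R)).
transitivity (\sum_m comparison_prob X m * \sum_(1 <= k < n.+1)
    (signature_event phi k m)%:R * (os k x)%:R).
  apply: eq_bigr => m _.
  have [->|m_neq0] := eqVneq (comparison_prob X m) 0; first by rewrite !mul0r.
  have [w <- x_inj] := comparison_prob_neq0 X_ac m_neq0.
  have [y [yx yE ->]] := sum_quality_event (fun y => (phi y)%:R) x x_inj.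
  rewrite -(sum_signature_os phi_semicoherent x_inj yx yE); congr (_ * _).
  by apply: eq_big_nat => k kn; rewrite signature_event_comparison.
under eq_bigr do rewrite mulr_sumr.
rewrite exchange_big /=; apply: eq_big_nat => k kn.
rewrite prob_signatureE // mulr_suml; apply: eq_bigr => m _.
by rewrite mulrA.
Qed.

End assembly.

Unset Implicit Arguments.

Theorem mainTheorem4 (R : realType) (d : measure_display)
    (Omega : measurableType d) (P : probability Omega R) (n : nat)
    (phi : cube n -> bool) (X : 'I_n -> {RV P >-> R})
    (phi_semicoherent : semicoherent phi)
    (X_ge0 : forall i w, 0 <= X i w)
    (X_ac : absolutely_continuous_joint_cdf X)
    (q_gt0 : forall S : {set 'I_n}, 0 < relative_quality X S) :
  unique
    (best_symmetric_approximation
       (fun x : cube n => relative_quality X (set_of_cube x))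
       (fun x : cube n => (phi x)%:R))
    (fun x : cube n =>
       \sum_(1 <= k < n.+1) prob_signature X phi k * (os k x)%:R).
Proof.
pose g (x : cube n) :=
  \sum_(1 <= k < n.+1) prob_signature X phi k * (os k x)%:R.
have g_level x y : level x = level y -> g x = g y.
  by move=> xy; apply: eq_big_nat => k kn; rewrite !osE // xy.
apply: unique_best_symmetric_approximation => [x|s x|x].
- exact: q_gt0.
- exact: g_level (level_perm s x).
under eq_bigr do rewrite mulrBr.
rewrite sumrB sum_relative_quality_phi // -/(g x).
apply/eqP; rewrite subr_eq0 eq_sym -[g x]mul1r.
rewrite -[X in X * _](sum_relative_quality X_ac x) mulr_suml; apply/eqP.
by apply: eq_bigr => y /eqP yx; rewrite (g_level _ _ (esym yx)).
Qed.
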